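(* Let $a<b$ and let $f:[a,b]\rightarrow\mathbb{R}$ be an absolutely continuous mapping with $f'\in L^2[a,b]$. Define \[ \sigma(f')=\|f'\|_2^2-\frac{(f(b)-f(a))^2}{b-a}. \] Then for all $x\in[a,\frac{a+b}{2}]$, \[ \left|\frac{f(x)+f(a+b-x)}{2}-\frac{1}{b-a}\int_{a}^{b}f(t)\,dt\right| \leq (b-a)^{-1/2} \left[\frac{(b-a)^2}{48}+\left(x-\frac{3a+b}{4}\right)^2\right]^{1/2}\sqrt{\sigma(f')}. \] This inequality is sharp in the sense that the constant $\frac{1}{48}$ on the right-hand side cannot be replaced by a smaller one.
   Context: $\|g\|_2=\left(\int_a^b g(t)^2\,dt\right)^{1/2}$. *)

(* Defs.v *)
From HB Require Import structures.
From mathcomp Require Import all_boot all_order all_algebra.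
From mathcomp Require Import all_classical all_reals all_analysis.
Set Implicit Arguments. Unset Strict Implicit. Unset Printing Implicit Defensive.
Import Order.TTheory GRing.Theory Num.Theory.
Local Open Scope classical_set_scope.
Local Open Scope ring_scope.

Definition abs_continuous (R : realType) (a b : R) (f : R -> R) : Prop :=
  forall e : R, 0 < e -> exists2 d : R, 0 < d &
    forall (n : nat) (s t : 'I_n -> R),
      (forall i, a <= s i /\ s i <= t i /\ t i <= b) ->
      (forall i j, i != j -> t i <= s j \/ t j <= s i) ->
      \sum_(i < n) (t i - s i) < d ->
      \sum_(i < n) `|f (t i) - f (s i)| < e.

Definition ae_derivative (R : realType) (a b : R) (f g : R -> R) : Prop :=
  {ae (@lebesgue_measure R), forall x, x \in `]a, b[ -> is_derive x 1 f (g x)}.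

Definition L2_on (R : realType) (a b : R) (g : R -> R) : Prop :=
  (@lebesgue_measure R).-integrable `[a, b] (fun x => ((g x) ^+ 2)%:E).

Definition norm2_sq (R : realType) (a b : R) (g : R -> R) : R :=
  Rintegral (@lebesgue_measure R) `[a, b] (fun x => (g x) ^+ 2).

Definition sigma (R : realType) (a b : R) (f g : R -> R) : R :=
  norm2_sq a b g - (f b - f a) ^+ 2 / (b - a).

Definition mean_val (R : realType) (a b : R) (f : R -> R) : R :=
  (b - a)^-1 * Rintegral (@lebesgue_measure R) `[a, b] f.

(* LHS and RHS of the inequality, with the constant 1/48 replaced by c *)
Definition lhs23 (R : realType) (a b : R) (f : R -> R) (x : R) : R :=
  `|(f x + f (a + b - x)) / 2 - mean_val a b f|.

Definition rhs23 (R : realType) (c : R) (a b : R) (f g : R -> R) (x : R) : R :=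
  (Num.sqrt (b - a))^-1 *
  Num.sqrt (c * (b - a) ^+ 2 + (x - (3 * a + b) / 4) ^+ 2) *
  Num.sqrt (sigma a b f g).

(* Main.v *)
(* Write L = b - a, T = (f x + f (a + b - x)) / 2 - mean, and let K be the Peano
   kernel with K(t) = t - a, t - (a + b) / 2, t - b on [a, x], [x, a + b - x] and
   [a + b - x, b]. Integration by parts gives L T = int K f'; moreover int K = 0
   and int K^2 = L q, where q is the bracket in the statement. With
   m = (f b - f a) / L, expanding 0 <= int (f' - l K - m)^2 yields
   0 <= sigma - 2 l L T + l^2 L q for every l, so the discriminant is
   nonpositive, which is the claim.

   The derivative g is only known to have an integrable square and need not be
   measurable, so the expansion is never integrated directly. On each piece
   (g - l K - m)^2 - g^2 - 2 l f is the a.e. derivative of an absolutely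
   continuous function P and is bounded below by the integrable function
   - g^2 - 2 l f; hence the increment of P dominates the integral of the latter.
   This one-sided comparison follows from Lebesgue's differentiation theorem and
   the fact that an absolutely continuous function with a.e. nonnegative
   derivative is nondecreasing.

   Equality holds for f(t) = t^2 on [-1, 1] at x = -1, hence the sharpness. *)

Require Import Defs.
From HB Require Import structures.
From mathcomp Require Import all_boot all_order all_algebra.
From mathcomp Require Import all_classical all_reals all_analysis.
From mathcomp Require Import ring lra.
Set Implicit Arguments. Unset Strict Implicit. Unset Printing Implicit Defensive.
Import Order.TTheory GRing.Theory Num.Theory.
Import numFieldNormedType.Exports.
Local Open Scope classical_set_scope.
Local Open Scope ring_scope.

(** * Absolutely continuous functions on a segment: regularity and algebra *)

Section AbsoluteContinuity.
Context {R : realType}.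
Implicit Types (a b : R) (f g : R -> R).

Lemma abs_continuousS a b c d f : a <= c -> d <= b ->
  abs_continuous a b f -> abs_continuous c d f.
Proof.
move=> ac db + e e0 => /(_ e e0)[r r0 H]; exists r => // n s t st disj.
apply: H => // i; have [cs [sit td]] := st i.
by rewrite (le_trans ac cs) (le_trans td db).
Qed.

Lemma abs_continuous_cst a b (k : R) : abs_continuous a b (fun=> k).
Proof.
move=> e e0; exists 1 => // n s t _ _ _.
by rewrite big1// => i _; rewrite subrr normr0.
Qed.

Lemma abs_continuous_id a b : abs_continuous a b id.
Proof.
move=> e e0; exists e => // n s t st _; apply: le_lt_trans.
apply: ler_sum => i _; have [_ [sit _]] := st i.
by rewrite ger0_norm// subr_ge0.
Qed.

Lemma abs_continuous_dist_lt a b f : abs_continuous a b f ->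
  forall e, 0 < e -> exists2 d, 0 < d &
    forall x y, a <= x <= b -> a <= y <= b -> `|x - y| < d -> `|f x - f y| < e.
Proof.
move=> acf e e0; have [d d0 H] := acf e e0; exists d => //.
have D x y : a <= x -> x <= y -> y <= b -> y - x < d -> `|f y - f x| < e.
  move=> ax xy yb xyd.
  have := H 1%N (fun=> x) (fun=> y) (fun _ => conj ax (conj xy yb)).
  rewrite !big_ord1; apply => // i j; by rewrite !ord1 eqxx.
move=> x y /andP[ax xb] /andP[ay yb]; have [xy|/ltW yx] := leP x y.
  by rewrite distrC [`|f _ - _|]distrC ger0_norm ?subr_ge0//; exact: D.
by rewrite ger0_norm ?subr_ge0//; exact: D.
Qed.

Lemma abs_continuous_continuous a b f : abs_continuous a b f ->
  {within `[a, b], continuous f}.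
Proof.
move=> acf; apply/subspace_continuousP => x /= xab.
apply/cvgrPdist_lt => e e0.
have [d d0 H] := abs_continuous_dist_lt acf e0.
rewrite near_withinE; near=> y => yab.
apply: H; [by move: xab; rewrite in_itv|by move: yab; rewrite /= in_itv|].
by near: y; apply: cvgr_dist_lt.
Unshelve. all: by end_near. Qed.

Lemma abs_continuous_integrable a b f : abs_continuous a b f ->
  (@lebesgue_measure R).-integrable `[a, b] (EFin \o f).
Proof.
move=> acf; apply: continuous_compact_integrable; first exact: segment_compact.
exact: abs_continuous_continuous.
Qed.

Lemma abs_continuous_bounded a b f : abs_continuous a b f ->
  exists2 M, 0 < M & forall x, a <= x <= b -> `|f x| <= M.
Proof.
move=> acf.
have /compact_bounded[M [_ HM]] :=
  continuous_compact (abs_continuous_continuous acf) (@segment_compact _ a b).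
exists (`|M| + 1); first by rewrite ltr_wpDl.
move=> x xab; apply: (HM (`|M| + 1)); first by rewrite ltr_pwDr// ler_norm.
by exists x => //=; rewrite in_itv.
Qed.

Lemma abs_continuousD a b f g : abs_continuous a b f -> abs_continuous a b g ->
  abs_continuous a b (fun x => f x + g x).
Proof.
move=> acf acg e e0; have e20 : 0 < e / 2 by rewrite divr_gt0.
have [d d0 Hf] := acf _ e20; have [d' d'0 Hg] := acg _ e20.
exists (Num.min d d'); first by rewrite lt_min d0.
move=> n s t st disj; rewrite lt_min => /andP[sd sd'].
rewrite [e]splitr; apply: le_lt_trans (ltrD (Hf n s t st disj sd) (Hg n s t st disj sd')).
rewrite -big_split/=; apply: ler_sum => i _.
by rewrite opprD addrACA ler_normD.
Qed.

Lemma abs_continuousM a b f g : abs_continuous a b f -> abs_continuous a b g ->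
  abs_continuous a b (fun x => f x * g x).
Proof.
move=> acf acg e e0; have e20 : 0 < e / 2 by rewrite divr_gt0.
(* The tolerances are crossed: the variation of [f] is weighted by the bound [M'] of [g] and that of
   [g] by the bound [M] of [f], so each half of the product increment stays below [e / 2]. *)
have [M M0 fM] := abs_continuous_bounded acf.
have [M' M'0 gM] := abs_continuous_bounded acg.
have [d d0 Hf] := acf (e / 2 / M') (divr_gt0 e20 M'0).
have [d' d'0 Hg] := acg (e / 2 / M) (divr_gt0 e20 M0).
exists (Num.min d d'); first by rewrite lt_min d0.
move=> n s t st disj; rewrite lt_min => /andP[sd sd'].
have := Hf n s t st disj sd; have := Hg n s t st disj sd'.
rewrite (ltr_pdivlMr _ _ M0) (ltr_pdivlMr _ _ M'0) => Sg Sf.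
rewrite [e]splitr; apply: le_lt_trans (ltrD Sf Sg).
rewrite !mulr_suml -big_split/=; apply: ler_sum => i _.
have [as_ [sit tb]] := st i.
have -> : f (t i) * g (t i) - f (s i) * g (s i) =
  (f (t i) - f (s i)) * g (t i) + (g (t i) - g (s i)) * f (s i) by ring.
apply: le_trans (ler_normD _ _) _; rewrite !normrM.
apply: lerD; apply: ler_wpM2l => //.
  by apply: gM; rewrite tb (le_trans as_ sit).
by apply: fM; rewrite as_ (le_trans sit tb).
Qed.

End AbsoluteContinuity.

(** * Covering argument: monotonicity from an almost everywhere nonnegative derivative *)

Lemma cousin_segment {R : realType} (Q : R -> R -> Prop) (a b : R) : a <= b ->
  (forall x y z, a <= x -> x <= y -> y <= z -> z <= b ->
    Q x y -> Q y z -> Q x z) ->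
  (forall z, a <= z <= b -> exists2 e, 0 < e &
    forall x y, a <= x -> x <= z -> z <= y -> y <= b ->
      z - e < x -> y < z + e -> Q x y) ->
  Q a b.
Proof.
move=> ab Qtrans Qloc.
(* Supremum argument: the local hypothesis at [sup S] carries [Q a] past that supremum, which is
   absurd unless it equals [b]. *)
pose S := [set y | a <= y <= b /\ Q a y].
have Sa : S a.
  split; first by rewrite lexx.
  have [|e e0 He] := Qloc a; first by rewrite lexx.
  by apply: He; rewrite ?gtrBl ?ltrDl.
have supS : has_sup S by split; [exists a|exists b => y [/andP[]]].
set c := sup S.
have ac : a <= c by apply: ub_le_sup => //; case: supS.
have cb : c <= b by apply: ge_sup; [exists a|move=> y [/andP[]]].
have [|e e0 He] := Qloc c; first by rewrite ac.
have [y [/andP[ay yb] Qay] cey] := sup_adherent e0 supS.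
have yc : y <= c by apply: ub_le_sup; [case: supS|split => //; rewrite ay].
(* Halving [e] keeps [d] strictly inside the neighbourhood of [c], and [d] exceeds [c] unless
   [c = b]. *)
pose d := Num.min b (c + e / 2).
have cd : c <= d by rewrite le_min cb lerDl divr_ge0// ltW.
have dltce : d < c + e by rewrite gt_min ltrD2l; apply/orP; right; lra.
have db : d <= b by rewrite ge_min lexx.
have Qad : Q a d by apply: (Qtrans a y d) => //; [exact: le_trans cd|exact: He].
have dc : d <= c.
  by apply: ub_le_sup; [case: supS|split => //; rewrite db (le_trans ac)].
have : d = b.
  by move: dc; rewrite /d; case: (leP b (c + e / 2)) => // _; lra.
by move=> <-.
Qed.

Section DisjointIntervals.
Context {R : realType} (n : nat) (s t : 'I_n -> R).
Notation mu := (@lebesgue_measure R).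
Hypothesis st : forall i, s i <= t i.
Hypothesis disj : forall i j, i != j -> t i <= s j \/ t j <= s i.

(** The family may share endpoints; dropping the left ones makes it disjoint without changing
    lengths. *)
Lemma trivIset_itv_oc : trivIset setT (fun i => `]s i, t i]%classic).
Proof.
apply/trivIsetP => i j _ _ ij; rewrite -subset0 => x /=.
rewrite !in_itv/= => -[/andP[six xti] /andP[sjx xtj]].
by case: (disj ij) => h; lra.
Qed.

Lemma lebesgue_measure_bigsetU_itv_oc :
  mu (\big[setU/set0]_(i < n) `]s i, t i]%classic) = (\sum_(i < n) (t i - s i))%:E.
Proof.
rewrite measure_bigsetU_ord//; last exact: trivIset_itv_oc.
rewrite -sumEFin; apply: eq_bigr => i _.
transitivity (mu `]s i, t i]%classic) => //.
rewrite lebesgue_measure_itv/= lte_fin; case: ltP => // ts.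
by congr EFin; apply/eqP; rewrite eq_sym subr_eq0 eq_le ts st.
Qed.

End DisjointIntervals.

(** Slopes from [z] to nearby points exceed [- eps]; the increments on the two sides of [z] are then
    added. The point [z] lies between [x] and [y], as the local hypothesis of [cousin_segment]
    provides. *)
Lemma is_derive_ge0_near {R : realType} (H : R -> R) (z d eps : R) :
  is_derive z 1 H d -> 0 <= d -> 0 < eps ->
  exists2 e, 0 < e & forall x y, x <= z -> z <= y -> z - e < x -> y < z + e ->
    - (eps * (y - x)) <= H y - H x.
Proof.
move=> [dH Hd] d0 eps0.
have : h^-1 *: (H (h *: 1 + z) - H z) @[h --> 0^'] --> d by rewrite -Hd; exact: dH.
move=> /cvgrPdist_lt /(_ _ eps0)[e /= e0 He].
have slope w : `|w - z| < e -> w != z -> - eps < (w - z)^-1 * (H w - H z).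
  move=> we wz.
  have /= := He (w - z); rewrite sub0r normrN subr_eq0 => /(_ we wz).
  rewrite /GRing.scale/= mulr1 subrK ltr_norml => /andP[_]; lra.
exists e => // x y xz zy zex yze.
have Hy : - (eps * (y - z)) <= H y - H z.
  move: zy; rewrite le_eqVlt => /predU1P[->|zy]; first by rewrite !subrr mulr0 oppr0.
  have yz0 : 0 < y - z by rewrite subr_gt0.
  have := slope y; rewrite gtr0_norm// gt_eqF// ltrBlDl => /(_ yze isT)/ltW.
  by rewrite ler_pdivlMl// mulrN mulrC.
have Hx : - (eps * (z - x)) <= H z - H x.
  move: xz; rewrite le_eqVlt => /predU1P[->|xz]; first by rewrite !subrr mulr0 oppr0.
  have xz0 : 0 < z - x by rewrite subr_gt0.
  have := slope x; rewrite distrC gtr0_norm// lt_eqF// => /(_ _ isT)/ltW.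
  rewrite -[x - z]opprB -[H x - H z]opprB invrN mulrNN ler_pdivlMl//.
  by rewrite mulrN mulrC; apply; lra.
have -> : eps * (y - x) = eps * (y - z) + eps * (z - x) by ring.
by lra.
Qed.

(* An interval around a point of the exceptional null set is placed inside an
   open set of small measure, where absolute continuity bounds the variation of
   [H]; around any other point the derivative controls the increment. *)
Lemma abs_continuous_ae_derive_ge0 {R : realType} (a b : R) (H : R -> R) :
  a <= b -> abs_continuous a b H ->
  {ae (@lebesgue_measure R), forall x, x \in `]a, b[ ->
    exists2 d, is_derive x 1 H d & 0 <= d} ->
  H a <= H b.
Proof.
move=> ab acH aeH.
(* The term [eps * (b - a)] is lost at points with a derivative, the other [eps] near the null set;
   they add up to [e] for [eps = e / (b - a + 1)]. *)
suff He eps : 0 < eps -> - (eps * (b - a) + eps) <= H b - H a.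
  rewrite -subr_ge0; apply/ler_addgt0Pr => e e0.
  have ba0 : 0 < b - a + 1 by rewrite ltr_wpDl// subr_ge0.
  have /He : 0 < e / (b - a + 1) by rewrite divr_gt0.
  rewrite -[X in _ + X]mulr1 -mulrDr divfK ?gt_eqF//; lra.
move=> eps0.
have [d d0 Hd] := acH _ eps0.
have [N [mN N0 aeN]] := aeH.
(* The derivative is only given on the open interval, so the endpoints join the exceptional set. *)
pose N' := N `|` [set a; b].
have mN' : measurable N' by apply: measurableU => //; exact: measurableU.
have N'0 : lebesgue_measure N' = 0%E.
  apply/negligibleP => //; apply: negligibleU; first exact/negligibleP.
  by apply/negligibleP; [exact: measurableU|apply: countable_lebesgue_measure0;
    exact: finite_set_countable].
have [|U [oU N'U muU]] := lebesgue_regularity_outer mN' _ d0.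
  by rewrite [ltLHS](_ : _ = 0%E).
have mU : measurable U by exact: measurable_realfun.open_measurable.
have {}muU : (lebesgue_measure U < d%:E)%E.
  apply: le_lt_trans muU; apply: (@le_trans _ _ (lebesgue_measure ((U `\` N') `|` N'))).
    apply: le_measure; rewrite ?inE//.
      by apply: measurableU => //; exact: measurableD.
    by move=> x Ux /=; have [|] := pselect (N' x); [right|left].
  apply: le_trans (measureU2 _ _ mN') _; first exact: measurableD.
  by rewrite [X in (_ + X)%E](_ : _ = 0%E) ?adde0.
(* The drop of [H] from [x] to [y] is at most [eps * (y - x)] plus its variation over finitely many
   nonoverlapping intervals in [U]. No smallness is built in, so [Q] passes to adjoining intervals;
   only on [[a, b]] is the total length compared with the measure of [U], which is less than [d]. *)
pose Q x y := exists (n : nat) (s t : 'I_n -> R),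
  [/\ forall i, x <= s i /\ s i <= t i /\ t i <= y,
      forall i j, i != j -> t i <= s j \/ t j <= s i,
      forall i, `]s i, t i] `<=` U &
      - (eps * (y - x) + \sum_(i < n) `|H (t i) - H (s i)|) <= H y - H x].
suff [n [s [t [st disj stU HQ]]]] : Q a b.
  suff Sd : \sum_(i < n) (t i - s i) < d.
    by have := Hd n s t st disj Sd; lra.
  have st' i : s i <= t i by have [_ []] := st i.
  rewrite -lte_fin -lebesgue_measure_bigsetU_itv_oc//.
  apply: le_lt_trans muU; apply: le_measure; rewrite ?inE//.
    exact: bigsetU_measurable.
  by rewrite -bigcup_seq => x [i _]; exact: stU.
apply: cousin_segment => //.
- move=> x y z ax xy yz zb [n [s [t [st disj stU HQ]]]].
  move=> [n' [s' [t' [st' disj' stU' HQ']]]].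
  exists (n + n')%N.
  exists (fun i => match fintype.split i with inl j => s j | inr j => s' j end).
  exists (fun i => match fintype.split i with inl j => t j | inr j => t' j end).
  split.
  + move=> i; case: (fintype.split i) => j.
      by have [? [? ?]] := st j; split; [|split] => //; lra.
    by have [? [? ?]] := st' j; split; [|split] => //; lra.
  (* Distinct indices stay distinct after [fintype.split]; intervals from different families are
     separated by [y]. *)
  + move=> i j; rewrite -(inj_eq (can_inj (@splitK _ _))).
    case: (fintype.split i) => i'; case: (fintype.split j) => j' ij.
    * by apply: disj; apply: contra_neq ij => ->.
    * by left; have [_ [_ ?]] := st i'; have [? _] := st' j'; lra.
    * by right; have [_ [_ ?]] := st j'; have [? _] := st' i'; lra.
    * by apply: disj'; apply: contra_neq ij => ->.
  + by move=> i; case: (fintype.split i) => j; [exact: stU|exact: stU'].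
  + rewrite big_split_ord/=.
    have spl i : fintype.split (lshift n' i) = inl i by exact: (unsplitK (inl i)).
    have spr i : fintype.split (rshift n i) = inr i by exact: (unsplitK (inr i)).
    rewrite (eq_bigr (fun i => `|H (t i) - H (s i)|)); last by move=> i _; rewrite spl.
    rewrite [X in _ + (_ + X)](eq_bigr (fun i => `|H (t' i) - H (s' i)|)); last first.
      by move=> i _; rewrite spr.
    by lra.
move=> z /andP[az zb]; have [Uz|nUz] := pselect (U z).
- have /nbhs_ballP[e /= e0 zeU] : nbhs z U by apply: open_nbhs_nbhs.
  exists e => // x y ax xz zy yb zex yze.
  exists 1%N, (fun=> x), (fun=> y); split.
  + by move=> _; split => //; split => //; lra.
  + by move=> i j; rewrite !ord1 eqxx.
  + move=> _ w /=; rewrite in_itv/= => /andP[xw wy].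
    by apply: zeU; rewrite /ball/= ltr_norml; apply/andP; split; lra.
  + rewrite big_ord1; have := ler_norm (- (H y - H x)); rewrite normrN.
    have : 0 <= eps * (y - x) by apply: mulr_ge0; lra.
    by lra.
- have nN'z : ~ N' z by move=> /N'U.
  have zab : z \in `]a, b[.
    rewrite in_itv/= !lt_neqAle az zb !andbT; apply/andP; split.
      by apply/eqP => za; apply: nN'z; right; left.
    by apply/eqP => zb'; apply: nN'z; right; right.
  have [D HD D0] : exists2 d, is_derive z 1 H d & 0 <= d.
    apply: contrapT => nD; apply: nN'z; left; by apply: aeN => /= /(_ zab).
  have [e e0 He] := is_derive_ge0_near HD D0 eps0.
  exists e => // x y ax xz zy yb zex yze.
  exists 0%N, (fun=> 0), (fun=> 0); split; [by case|by case|by case|].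
  by rewrite big_ord0 addr0; exact: He.
Qed.

(** * Indefinite integrals and the one-sided comparison with an increment *)

Section IndefiniteIntegral.
Context {R : realType}.
Notation mu := (@lebesgue_measure R).
Implicit Types (a b : R) (F G : R -> R).

Lemma integrable_restrict_segment a b G : mu.-integrable `[a, b] (EFin \o G) ->
  mu.-integrable setT (EFin \o (G \_ `[a, b])).
Proof. by move=> iG; rewrite -restrict_EFin -integrable_mkcond. Qed.

(** The variation over a nonoverlapping family is at most the integral of the absolute value of [G]
    over its union, which is small with the measure of that union. Extension by zero gives an
    integrable function on the whole line. *)
Lemma abs_continuous_integral a b G : mu.-integrable `[a, b] (EFin \o G) ->
  abs_continuous a b (fun x => \int[mu]_(t in `[a, x]) G t).
Proof.
move=> iG e e0; have iG0 := integrable_restrict_segment iG.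
set G0 := G \_ `[a, b] in iG0.
have [d [d0 Hd]] := integral_normr_continuous iG0 e0.
exists d => // n s t st disj sd.
have st' i : s i <= t i by have [_ []] := st i.
set D := \big[setU/set0]_(i < n) `]s i, t i]%classic.
have mD : measurable D by apply: bigsetU_measurable.
have muD : (mu D < d%:E)%E by rewrite /D lebesgue_measure_bigsetU_itv_oc// lte_fin.
apply: le_lt_trans (Hd _ mD muD).
have iN A : measurable A -> mu.-integrable A (EFin \o (fun x => `|G0 x|)).
  move=> mA; apply: (@integrableS _ _ _ _ setT) => //.
  by have := integrable_norm iG0.
rewrite /Rintegral integral_bigsetU_EFin ?index_enum_uniq//; last 2 first.
- by apply: sub_trivIset (trivIset_itv_oc disj).
- by apply: measurable_int (iN _ mD).
rewrite -sum_fine/=; last by move=> i _; apply: integrable_fin_num => //; exact: iN.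
apply: ler_sum => i _; have [as_ [sit tb]] := st i.
have sub : `]s i, t i] `<=` `[a, b].
  by apply: subset_itv; rewrite bnd_simp.
rewrite Rintegral_itvB ?bnd_simp//; last first.
  by apply: integrableS iG => //; apply: subset_itv; rewrite bnd_simp.
have -> : \int[mu]_(x in `]s i, t i]) G x = \int[mu]_(x in `]s i, t i]) G0 x.
  apply: eq_Rintegral => x; rewrite inE => xst.
  by rewrite /G0 patchE mem_set//; exact: sub.
apply: le_normr_Rintegral => //; exact: integrableS iG0.
Qed.

(** By Lebesgue differentiation, [F] minus the indefinite integral of [G] has an almost everywhere
    nonnegative derivative, hence is nondecreasing. *)
Lemma integral_le_abs_continuous a b F G : abs_continuous a b F ->
  mu.-integrable `[a, b] (EFin \o G) ->
  {ae mu, forall x, x \in `]a, b[ -> exists2 d, is_derive x 1 F d & G x <= d} ->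
  forall u v, a <= u -> u <= v -> v <= b ->
  \int[mu]_(x in `[a, v]) G x - \int[mu]_(x in `[a, u]) G x <= F v - F u.
Proof.
move=> acF iG aeF u v au uv vb; have iG0 := integrable_restrict_segment iG.
set G0 := G \_ `[a, b] in iG0.
have GG0 w : w <= b ->
    \int[mu]_(x in `[a, w]) G x = \int[mu]_(x in `[a, w]) G0 x.
  move=> wb; apply: eq_Rintegral => x xaw; rewrite /G0 patchE mem_set//.
  by move: xaw; rewrite inE/=; apply: subset_itv; rewrite bnd_simp.
rewrite !GG0//; last exact: le_trans vb.
pose Phi x := \int[mu]_(t in `[a, x]) G0 t.
have acPhi : abs_continuous a b Phi.
  by apply: abs_continuous_integral; exact: integrableS iG0.
have aePhi : {ae mu, forall x, a < x -> is_derive x 1 Phi (G0 x)}.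
  have := @FTC1 _ G0 (BLeft a) (fun y => integrableS measurableT _ _ iG0) _.
  have loc : locally_integrable [set: R] G0.
    by apply: open_integrable_locally => //; exact: openT.
  move=> /(_ _ _ loc)-/(_ (fun y => measurable_itv _) (fun y => @subsetT _ _)).
  apply: filterS; first exact: (ae_filter_ringOfSetsType mu).
  move=> x Hx ax; have [|dPhi Phi'] := Hx; first by rewrite (@lte_fin R).
  by split => //; rewrite -derive1E.
suff : F u + -1 * Phi u <= F v + -1 * Phi v by rewrite /Phi; lra.
apply: (abs_continuous_ae_derive_ge0 (H := fun x => F x + -1 * Phi x)) => //.
  apply: abs_continuousS au vb _; apply: abs_continuousD => //.
  by apply: abs_continuousM => //; exact: abs_continuous_cst.
move: aeF aePhi; apply: filterS2; first exact: (ae_filter_ringOfSetsType mu).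
move=> x HF HPhi xuv.
have xab : x \in `]a, b[ by apply: subset_itvSoo xuv.
have [d Fd Gd] := HF xab.
have dPhi := HPhi (proj1 (andP xab)).
exists (d - G0 x).
  by apply: is_derive_eq; rewrite scaleN1r.
by rewrite /G0 patchE mem_set ?subr_ge0//=; exact: subset_itv_oo_cc xab.
Qed.

End IndefiniteIntegral.

(** * The quadratic in [l] and the inequality *)

Section Inequality.
Context {R : realType}.
Notation mu := (@lebesgue_measure R).
Implicit Types (a b c l m : R) (f g : R -> R).

(* [square_primitive f l m c] is a primitive of
   [(f' - l (t - c) - m)^2 - f'^2 - 2 l f]. *)
Definition square_primitive f l m c (t : R) : R :=
  f t * (- 2 * l * (t - c) + - 2 * m) +
  (l ^+ 2 / 3 * ((t - c) * ((t - c) * (t - c))) +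
   (l * m * ((t - c) * (t - c)) + m ^+ 2 * t)).

Lemma abs_continuous_square_primitive a b f l m c : abs_continuous a b f ->
  abs_continuous a b (square_primitive f l m c).
Proof.
move=> acf; have cst := abs_continuous_cst a b.
have tc : abs_continuous a b (fun t => t - c).
  by apply: abs_continuousD => //; exact: abs_continuous_id.
have tc2 := abs_continuousM tc tc; have tc3 := abs_continuousM tc tc2.
apply: abs_continuousD.
  by apply: abs_continuousM => //; apply: abs_continuousD => //; apply: abs_continuousM.
apply: abs_continuousD; first exact: abs_continuousM.
apply: abs_continuousD; first exact: abs_continuousM.
by apply: abs_continuousM => //; exact: abs_continuous_id.
Qed.

Lemma is_derive_square_primitive f l m c (x d : R) : is_derive x 1 f d ->
  is_derive x 1 (square_primitive f l m c)
    ((d - l * (x - c) - m) ^+ 2 - d ^+ 2 - 2 * l * f x).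
Proof.
move=> fd; rewrite /square_primitive.
by apply: is_derive_eq; rewrite /GRing.scale/=; field.
Qed.

Lemma integral_le_square_primitive a b f g l m c u v :
  abs_continuous a b f -> ae_derivative a b f g -> L2_on a b g ->
  a <= u -> u <= v -> v <= b ->
  \int[mu]_(t in `[a, v]) (-1 * g t ^+ 2 + (- 2 * l) * f t) -
  \int[mu]_(t in `[a, u]) (-1 * g t ^+ 2 + (- 2 * l) * f t) <=
  square_primitive f l m c v - square_primitive f l m c u.
Proof.
move=> acf aef L2g au uv vb; set G := fun t => -1 * g t ^+ 2 + (- 2 * l) * f t.
apply: (integral_le_abs_continuous (a := a) (b := b)) => //.
- exact: abs_continuous_square_primitive.
- have -> : EFin \o G =
    ((fun t => (-1)%:E * (g t ^+ 2)%:E) \+ (fun t => (- 2 * l)%:E * (f t)%:E))%E.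
    by apply/funext => t.
  apply: integrableD => //; apply: integrableZl => //.
  exact: abs_continuous_integrable acf.
- move: aef; apply: filterS; first exact: (ae_filter_ringOfSetsType mu).
  move=> x fx xab.
  exists ((g x - l * (x - c) - m) ^+ 2 - g x ^+ 2 - 2 * l * f x).
    exact/is_derive_square_primitive/fx.
  (* The derivative of the primitive exceeds [G] by exactly this square. *)
  by have := sqr_ge0 (g x - l * (x - c) - m); rewrite /G; lra.
Qed.

Lemma sigma_quadratic_ge0 a b f g x l : a < b ->
  abs_continuous a b f -> ae_derivative a b f g -> L2_on a b g ->
  a <= x -> x <= (a + b) / 2 ->
  0 <= sigma a b f g
    - 2 * l * ((b - a) * ((f x + f (a + b - x)) / 2 - mean_val a b f))
    + l ^+ 2 * ((b - a) * (1 / 48 * (b - a) ^+ 2 + (x - (3 * a + b) / 4) ^+ 2)).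
Proof.
move=> ab acf aef L2g ax xm.
pose m := (f b - f a) / (b - a).
set y := a + b - x.
have xy : x <= y by rewrite /y; lra.
have yb : y <= b by rewrite /y; lra.
have xb := le_trans xy yb; have ay := le_trans ax xy.
(* The centres [a], [(a + b) / 2] and [b] are the zeros of the three branches of the Peano kernel;
   the integrals telescope when the three bounds are added. *)
have := integral_le_square_primitive l m a acf aef L2g (lexx a) ax xb.
have := integral_le_square_primitive l m ((a + b) / 2) acf aef L2g ax xy yb.
have := integral_le_square_primitive l m b acf aef L2g ay yb (lexx b).
rewrite set_itv1 Rintegral_set1.
have -> : \int[mu]_(t in `[a, b]) (-1 * g t ^+ 2 + (- 2 * l) * f t) =
    -1 * norm2_sq a b g + (- 2 * l) * \int[mu]_(t in `[a, b]) f t.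
  have fi := abs_continuous_integrable acf.
  have gi : mu.-integrable `[a, b] (EFin \o (fun t => g t ^+ 2)) := L2g.
  have iZ k h : mu.-integrable `[a, b] (EFin \o h) ->
      mu.-integrable `[a, b] (EFin \o (fun t => k * h t)).
    move=> hi.
    have -> : EFin \o (fun t => k * h t) = (fun t => k%:E * (h t)%:E)%E by [].
    exact: integrableZl.
  by rewrite RintegralD ?RintegralZl//; apply: iZ.
rewrite /mean_val /sigma.
set If := \int[mu]_(t in `[a, b]) f t; set N := norm2_sq a b g.
move=> h1 h2 h3.
have : -1 * N + - 2 * l * If <=
  (square_primitive f l m b b - square_primitive f l m b y) +
  (square_primitive f l m ((a + b) / 2) y - square_primitive f l m ((a + b) / 2) x) +
  (square_primitive f l m a x - square_primitive f l m a a) by lra.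
(* The two sides agree identically: the [l * m] terms cancel since the kernel has mean zero, and the
   terms in [m] alone sum to [- (f b - f a) ^+ 2 / (b - a)], turning [N] into [sigma]. *)
rewrite -subr_ge0; congr (0 <= _).
have ba0 : b - a != 0 by rewrite subr_eq0 gt_eqF.
by rewrite /square_primitive /m /y; field.
Qed.

(** [l = B / C] minimises the quadratic. *)
Lemma discriminant_le (A B C : R) : 0 < C ->
  (forall l, 0 <= A - 2 * l * B + l ^+ 2 * C) -> B ^+ 2 <= C * A.
Proof.
move=> C0 /(_ (B / C)); have C0' : C != 0 by rewrite gt_eqF.
have -> : A - 2 * (B / C) * B + (B / C) ^+ 2 * C = A - B ^+ 2 / C by field.
by rewrite subr_ge0 ler_pdivrMr// mulrC.
Qed.

Lemma lhs23_le_rhs23 a b f g x : a < b ->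
  abs_continuous a b f -> ae_derivative a b f g -> L2_on a b g ->
  a <= x -> x <= (a + b) / 2 ->
  lhs23 a b f x <= rhs23 (1 / 48) a b f g x.
Proof.
move=> ab acf aef L2g ax xm.
have ba0 : 0 < b - a by rewrite subr_gt0.
rewrite /lhs23 /rhs23; set q := 1 / 48 * _ + _; set B := (_ / 2 - _).
have q0 : 0 < q by rewrite ltr_wpDr ?sqr_ge0// mulr_gt0 ?exprn_gt0.
have := discriminant_le (mulr_gt0 ba0 q0)
  (fun l => sigma_quadratic_ge0 l ab acf aef L2g ax xm).
(* One factor [b - a] cancels, leaving [(b - a) * B ^+ 2] at most [q * sigma]; the roots are then
   merged and compared. *)
rewrite -/B exprMn expr2 -!mulrA ler_pM2l// => H.
have [L0 ql0] := (ltW ba0, ltW q0).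
rewrite -sqrtr_sqr -sqrtrV// -!sqrtrM ?mulr_ge0 ?invr_ge0//.
by apply: ler_wsqrtr; rewrite ler_pdivlMl.
Qed.

End Inequality.

(** * Sharpness of the constant *)

Section Sharpness.
Context {R : realType}.

Lemma integral_sqr : \int[@lebesgue_measure R]_(t in `[-1, 1]) (t ^+ 2) = 2 / 3.
Proof.
pose F (t : R) := 1 / 3 * (t * (t * t)).
have dF (t : R) : is_derive t 1 F (t ^+ 2).
  by apply: is_derive_eq; rewrite /GRing.scale/=; field.
have cF : continuous F.
  by move=> t; apply: differentiable_continuous; apply/derivable1_diffP; case: (dF t).
rewrite /Rintegral (@continuous_FTC2 _ _ F)/=.
- by rewrite /F; field.
- by lra.
- by apply: continuous_subspaceT => t; exact: exprn_continuous.
- split; first by move=> t _; case: (dF t).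
  + by apply: cvg_at_right_filter; exact: cF.
  + by apply: cvg_at_left_filter; exact: cF.
- by move=> t _; rewrite derive1E; case: (dF t).
Qed.

Lemma lhs23_sharp (c : R) : c < 1 / 48 ->
  exists (a b : R) (f g : R -> R) (x : R),
    [/\ a < b, abs_continuous a b f, ae_derivative a b f g & L2_on a b g] /\
    [/\ a <= x, x <= (a + b) / 2 & rhs23 c a b f g x < lhs23 a b f x].
Proof.
move=> c48.
have acx2 : abs_continuous (-1) 1 (fun t : R => t ^+ 2).
  by apply: abs_continuousM; exact: abs_continuous_id.
have ac2x2 : abs_continuous (-1) 1 (fun t : R => (2 * t) ^+ 2).
  by apply: abs_continuousM; apply: abs_continuousM;
    do ?[exact: abs_continuous_id|exact: abs_continuous_cst].
(* At [x = -1] the outer kernel branches degenerate and the kernel is [t], so [g] is twice the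
   kernel and the discriminant bound is attained. *)
exists (-1), 1, (fun t => t ^+ 2), (fun t => 2 * t), (-1).
split; first split.
- by lra.
- exact: acx2.
- apply: aeW => x _; apply: is_derive_eq.
  by rewrite /GRing.scale/=; ring.
- exact: abs_continuous_integrable ac2x2.
split; [by []|by lra|].
have N : norm2_sq (-1) 1 (fun t : R => 2 * t) = 8 / 3.
  rewrite /norm2_sq; under eq_Rintegral do rewrite exprMn.
  rewrite RintegralZl//; last exact: abs_continuous_integrable acx2.
  by rewrite integral_sqr; field.
rewrite /rhs23 /lhs23 /mean_val /sigma N integral_sqr.
have -> : ((-1) ^+ 2 + (-1 + 1 - -1) ^+ 2) / 2 - (1 - -1)^-1 * (2 / 3) = 2 / 3 :> R.
  by field.
have -> : 8 / 3 - (1 ^+ 2 - (-1) ^+ 2) ^+ 2 / (1 - -1) = 8 / 3 :> R by field.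
have -> : c * (1 - -1) ^+ 2 + (-1 - (3 * -1 + 1) / 4) ^+ 2 = 4 * c + 1 / 4 by field.
rewrite -sqrtrV; last by lra.
rewrite -sqrtrM; last by rewrite invr_ge0; lra.
rewrite (@ger0_norm _ (2 / 3)); last by lra.
have -> : 2 / 3 = Num.sqrt ((2 / 3) ^+ 2) :> R by rewrite sqrtr_sqr ger0_norm//; lra.
(* [4 * c + 1 / 4] may be negative, where its root is 0 by default; merging roots asks for a
   nonnegative first factor, so [8 / 3] moves to the front. *)
rewrite [_ * Num.sqrt (8 / 3)]mulrC -sqrtrM; last by lra.
(* Under the roots the claim is linear in [c]: [4 / 3 * (4 * c + 1 / 4) < 4 / 9], that is,
   [c < 1 / 48]. *)
rewrite ltr_sqrt; last by rewrite exprn_gt0//; lra.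
have -> : (1 - -1)^-1 = 1 / 2 :> R by field.
by lra.
Qed.

End Sharpness.

Unset Implicit Arguments.

Theorem theorem2p3 (R : realType) :
  (forall (a b : R) (f g : R -> R),
     a < b -> abs_continuous a b f -> ae_derivative a b f g -> L2_on a b g ->
     forall x : R, a <= x -> x <= (a + b) / 2 ->
       lhs23 a b f x <= rhs23 (1 / 48) a b f g x)
  /\
  (forall c : R, c < 1 / 48 ->
     exists (a b : R) (f g : R -> R) (x : R),
       [/\ a < b, abs_continuous a b f, ae_derivative a b f g & L2_on a b g] /\
       [/\ a <= x, x <= (a + b) / 2 & rhs23 c a b f g x < lhs23 a b f x]).
Proof.
split; last exact: lhs23_sharp.
by move=> a b f g ab acf aef L2g x ax xm; exact: lhs23_le_rhs23.
Qed.
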